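(* Let $\langle\mathsf{o}\rangle$ denote either of the operators $\langle\mathsf{sb}\rangle,\langle\mathsf{sw}\rangle$ and let $k$ be a natural number. The satisfiability problem of $\mathcal{ML}(\langle\mathsf{o}\rangle)$ over models of width bounded by $k$ is decidable: there is an algorithm which, given a formula $\varphi$ of $\mathcal{ML}(\langle\mathsf{o}\rangle)$, decides whether there exist a model $\mathcal{M}=\langle W,R,V\rangle$ in which every state has at most $k$ $R$-successors and a state $w\in W$ such that $\mathcal{M},w\models\varphi$.
   Context: A model is $\mathcal{M}=\langle W,R,V\rangle$ with $W\neq\emptyset$, $R\subseteq W\times W$, $V:\mathsf{PROP}\to\mathcal{P}(W)$, where $\mathsf{PROP}$ is a countably infinite set of propositional symbols. Formulas of $\mathcal{ML}(\langle\mathsf{o}\rangle)$: $\bot\mid p\mid\neg\varphi\mid\varphi\wedge\psi\mid\Diamond\varphi\mid\langle\mathsf{o}\rangle\varphi$. The Boolean clauses are as usual, $\mathcal{M},w\models p$ iff $w\in V(p)$, and $\mathcal{M},w\models\Diamond\varphi$ iff $\mathcal{M},v\models\varphi$ for some $v$ with $(w,v)\in R$. Further: - (local sabotage) $\mathcal{M},w\models\langle\mathsf{sb}\rangle\varphi$ iff for some $v$ with $(w,v)\in R$, $\langle W,R\setminus\{(w,v)\},V\rangle,v\models\varphi$; - (local swap) $\mathcal{M},w\models\langle\mathsf{sw}\rangle\varphi$ iff for some $v$ with $(w,v)\in R$, $\langle W,(R\setminus\{(w,v)\})\cup\{(v,w)\},V\rangle,v\models\varphi$. Only the initial model $\mathcal{M}$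 is required to satisfy the width bound. *)

(* Defs.v *)
From Stdlib Require Cantor.
From mathcomp Require Import all_boot.
From mathcomp Require Import boolp classical_sets functions cardinality.

Set Implicit Arguments.
Unset Strict Implicit.
Unset Printing Implicit Defensive.

Local Open Scope classical_set_scope.
Local Open Scope card_scope.

(** Syntax.  Propositional symbols are natural numbers; [Op] is the
    model-changing modality, whose meaning is fixed by an [operator]. *)

Inductive operator := Sabotage | Swap.

Inductive formula :=
  | Bot
  | Var of nat
  | Neg of formula
  | And of formula & formula
  | Dia of formula
  | Op of formula.

Record model := Model {
  world :> Type;
  world_inhabited : inhabited world;
  acc : set (world * world);
  valuation : nat -> set world
}.

Arguments acc : clear implicits.
Arguments valuation : clear implicits.

Definition with_acc (M : model) (R : set (M * M)) : model :=
  Model (world_inhabited M) R (valuation M).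

(** The accessibility relation after traversing the edge [(w, v)].  In the swap
    case the deletion comes first, so swapping a loop leaves it in place. *)
Definition update (o : operator) (M : model) (w v : M) : set (M * M) :=
  match o with
  | Sabotage => acc M `\ (w, v)
  | Swap => (acc M `\ (w, v)) `|` [set (v, w)]
  end.

Fixpoint satisfies (o : operator) (M : model) (w : M) (phi : formula) : Prop :=
  match phi with
  | Bot => False
  | Var p => valuation M p w
  | Neg psi => ~ satisfies o w psi
  | And psi chi => satisfies o w psi /\ satisfies o w chi
  | Dia psi => exists v : M, acc M (w, v) /\ satisfies o v psi
  | Op psi => exists v : M, acc M (w, v) /\
      @satisfies o (with_acc (update o w v)) v psi
  end.

Definition width_le (k : nat) (M : model) : Prop :=
  forall w : M, [set v | acc M (w, v)] #<= `I_k.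

Definition satisfiable (o : operator) (k : nat) : set formula :=
  [set phi | exists M : model, width_le k M /\ exists w : M, satisfies o w phi].

(** Total recursive functions of any arity (Kleene): the least class containing
    the zero functions, the successor and the projections, and closed under
    composition, primitive recursion and minimization of regular functions. *)
Inductive recursive : forall n : nat, (n.-tuple nat -> nat) -> Prop :=
  | rec_zero n : recursive (fun _ : n.-tuple nat => 0)
  | rec_succ : recursive (fun v : 1.-tuple nat => (thead v).+1)
  | rec_proj n (i : 'I_n) : recursive (fun v : n.-tuple nat => tnth v i)
  | rec_comp m n (f : m.-tuple nat -> nat) (g : 'I_m -> n.-tuple nat -> nat) :
      recursive f -> (forall i, recursive (g i)) ->
      recursive (fun v : n.-tuple nat => f [tuple g i v | i < m])
  | rec_prim n (f : n.-tuple nat -> nat) (g : n.+2.-tuple nat -> nat)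
        (h : n.+1.-tuple nat -> nat) :
      recursive f -> recursive g ->
      (forall v : n.-tuple nat, h [tuple of 0 :: v] = f v) ->
      (forall y (v : n.-tuple nat),
         h [tuple of y.+1 :: v] = g [tuple of y :: h [tuple of y :: v] :: v]) ->
      recursive h
  | rec_min n (f : n.+1.-tuple nat -> nat) (h : n.-tuple nat -> nat) :
      recursive f ->
      (forall v : n.-tuple nat, f [tuple of h v :: v] = 0) ->
      (forall (v : n.-tuple nat) y, y < h v -> f [tuple of y :: v] <> 0) ->
      recursive h.

(** Gödel numbering: a constructor tag paired with the code of the arguments,
    by the Cantor pairing function. *)
Fixpoint code (phi : formula) : nat :=
  match phi with
  | Bot => Cantor.to_nat (0, 0)
  | Var p => Cantor.to_nat (1, p)
  | Neg psi => Cantor.to_nat (2, code psi)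
  | And psi chi => Cantor.to_nat (3, Cantor.to_nat (code psi, code chi))
  | Dia psi => Cantor.to_nat (4, code psi)
  | Op psi => Cantor.to_nat (5, code psi)
  end.

Lemma code_inj : injective code.
Proof.
have inj a b c d : Cantor.to_nat (a, b) = Cantor.to_nat (c, d) -> a = c /\ b = d.
  by move=> /(Cantor.to_nat_inj (a, b) (c, d)) [-> ->].
elim=> [|p|phi IH|phi IH1 psi IH2|phi IH|phi IH] [|q|phi'|phi' psi'|phi'|phi'];
  cbn [code] => E; have [//] := inj _ _ _ _ E => _ {}E.
- by rewrite E.
- by rewrite (IH _ E).
- by have [/IH1 -> /IH2 ->] := inj _ _ _ _ E.
- by rewrite (IH _ E).
- by rewrite (IH _ E).
Qed.

(** A set of formulas is decidable when its characteristic function is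
    recursive on codes. *)
Definition decidable_set (A : set formula) : Prop :=
  exists f : 1.-tuple nat -> nat,
    recursive f /\ forall phi : formula, f [tuple code phi] = `[< A phi >].

(* Main.v *)
Require Import Defs.
From Stdlib Require Cantor.
From mathcomp Require Import all_boot zify.
From mathcomp Require Import boolp classical_sets functions cardinality.

(** Evaluating a formula of modal depth [d] at [w] only visits states within
    distance [d] of [w] in the initial relation: a swap only adds edges back to
    a state that has already been visited.  In a model of width at most [k]
    there are at most [(k+1)^d] such states, and restricting the model to them
    preserves the width bound, so it suffices to examine finitely many finite
    models.  A finite model is a pair of numbers, whose binary digits list the
    edges and the valuation.  Rather than evaluating formulas by recursion, the
    algorithm searches for a number [T] whose digits form a truth table that
    obeys the clauses of [satisfies] for all relevant models, states and
    formulas.  The clauses only involve bounded quantifiers, and such a [T]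
    exists for every input, so minimization is total. *)

Set Implicit Arguments.
Unset Strict Implicit.
Unset Printing Implicit Defensive.

Local Open Scope classical_set_scope.
Local Open Scope card_scope.

(** * Closure properties of recursive functions *)

Definition bit (t i : nat) : bool := odd (iter i half t).

Definition pair (x y : nat) : nat := Cantor.to_nat (x, y).

Definition all_lt (b : nat) (P : nat -> bool) : bool := all P (iota 0 b).

Definition has_lt (b : nat) (P : nat -> bool) : bool := has P (iota 0 b).

(** Written as a tuple of projections, so that precomposition with it is directly an instance of
    [rec_comp]. *)
Definition behead_tup n (v : n.+1.-tuple nat) : n.-tuple nat :=
  [tuple tnth v (lift ord0 i) | i < n].

Lemma behead_tupE n x (v : n.-tuple nat) : behead_tup [tuple of x :: v] = v.
Proof. by apply: eq_from_tnth => i; rewrite tnth_mktuple tnthS. Qed.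

Lemma rec_ext n (F G : n.-tuple nat -> nat) :
  F =1 G -> recursive F -> recursive G.
Proof. by move=> /funext ->. Qed.

Lemma rec_thead n : recursive (fun v : n.+1.-tuple nat => thead v).
Proof. exact: rec_proj. Qed.

Lemma rec_behead n (F : n.-tuple nat -> nat) :
  recursive F -> recursive (fun v : n.+1.-tuple nat => F (behead_tup v)).
Proof. by move=> rF; apply: rec_comp rF _ => i; apply: rec_proj. Qed.

Lemma rec_comp1 n (f : nat -> nat) (F : n.-tuple nat -> nat) :
  recursive (fun v : 1.-tuple nat => f (thead v)) -> recursive F ->
  recursive (fun v => f (F v)).
Proof.
move=> rf rF; apply: rec_ext (rec_comp rf (g := fun=> F) (fun=> rF)) => v.
by rewrite /thead tnth_mktuple.
Qed.

Lemma rec_S n (F : n.-tuple nat -> nat) :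
  recursive F -> recursive (fun v => (F v).+1).
Proof. exact/rec_comp1/rec_succ. Qed.

Lemma rec_const n c : recursive (fun _ : n.-tuple nat => c).
Proof. by elim: c => [|c IH]; [exact: rec_zero | exact: rec_S IH]. Qed.

(** [rec_prim] recurses on the first component of a tuple; composing it with [B] in that place gives
    recursion up to a computed bound. *)
Lemma rec_natrec n (F B : n.-tuple nat -> nat)
    (G : nat -> nat -> n.-tuple nat -> nat) :
  recursive B -> recursive F ->
  recursive (fun v : n.+2.-tuple nat =>
    G (thead v) (thead (behead_tup v)) (behead_tup (behead_tup v))) ->
  recursive (fun v => nat_rec _ (F v) (fun y r => G y r v) (B v)).
Proof.
move=> rB rF rG.
pose h (v : n.+1.-tuple nat) :=
  nat_rec (fun=> nat) (F (behead_tup v)) (fun y r => G y r (behead_tup v))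
    (thead v).
have rh : recursive h.
  apply: rec_prim rF rG _ _ => [v|y v]; rewrite /h !theadE !behead_tupE //=.
pose g (i : 'I_n.+1) v := if unlift ord0 i is Some j then tnth v j else B v.
have rg i : recursive (g i).
  by rewrite /g; case: (unlift ord0 i) => [j|] //; apply: rec_proj.
apply: rec_ext (rec_comp rh rg) => v.
have -> : [tuple g i v | i < n.+1] = [tuple of B v :: v].
  apply: eq_from_tnth => i; rewrite tnth_mktuple /g.
  by case: unliftP => [j|] ->; rewrite ?tnthS ?tnth0.
by rewrite /h theadE behead_tupE.
Qed.

(** An instance of [rec_min], regular because of [exP]; as minimization looks for a zero, [P] is
    negated. *)
Lemma rec_search n (P : nat -> n.-tuple nat -> bool)
    (exP : forall v, exists y, P y v) :
  recursive (fun v : n.+1.-tuple nat => P (thead v) (behead_tup v) : nat) ->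
  recursive (fun v => ex_minn (exP v)).
Proof.
move=> rP; pose f (v : n.+1.-tuple nat) : nat := ~~ P (thead v) (behead_tup v).
have rf : recursive f.
  have rneg : recursive (fun v : 1.-tuple nat =>
      nat_rec (fun=> nat) 1 (fun _ _ => 0) (thead v)).
    by apply: (rec_natrec (F := fun=> 1) (G := fun _ _ _ => 0));
      [exact: rec_thead | exact: rec_const | exact: rec_const].
  apply: rec_ext (rec_comp1 rneg rP) => v.
  by rewrite /f; case: (P _ _).
apply: rec_min rf _ _ => [v|v y]; rewrite /f theadE behead_tupE.
  by case: ex_minnP => m ->.
by case: ex_minnP => m _ min_m ltym; case: (boolP (P y v)) => // /min_m; lia.
Qed.

Lemma rec_add n (F G : n.-tuple nat -> nat) :
  recursive F -> recursive G -> recursive (fun v => F v + G v).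
Proof.
move=> rF rG.
apply: rec_ext (rec_natrec (G := fun _ r _ => r.+1) rG rF _) => [v|].
  by elim: (G v) => [|m IH] /=; rewrite ?IH; lia.
by apply: rec_S; apply: rec_behead; apply: rec_thead.
Qed.

Lemma rec_pred n (F : n.-tuple nat -> nat) :
  recursive F -> recursive (fun v => (F v).-1).
Proof.
move=> rF.
apply: rec_ext
  (rec_natrec (G := fun y _ _ => y) rF (rec_const n 0) _) => [v|].
  by case: (F v).
exact: rec_thead.
Qed.

Lemma rec_sub n (F G : n.-tuple nat -> nat) :
  recursive F -> recursive G -> recursive (fun v => F v - G v).
Proof.
move=> rF rG.
apply: rec_ext (rec_natrec (G := fun _ r _ => r.-1) rG rF _) => [v|].
  by elim: (G v) => [|m IH] /=; rewrite ?IH; lia.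
by apply: rec_pred; apply: rec_behead; apply: rec_thead.
Qed.

Lemma rec_if n (b : n.-tuple nat -> bool) (F G : n.-tuple nat -> nat) :
  recursive (fun v => b v : nat) -> recursive F -> recursive G ->
  recursive (fun v => if b v then F v else G v).
Proof.
move=> rb rF rG.
apply: rec_ext (rec_natrec (G := fun _ _ => F) rb rG _) => [v|].
  by case: (b v).
exact: rec_behead (rec_behead rF).
Qed.

Lemma rec_negb n (b : n.-tuple nat -> bool) :
  recursive (fun v => b v : nat) -> recursive (fun v => ~~ b v : nat).
Proof.
move=> rb; apply: rec_ext (rec_if rb (rec_const n 0) (rec_const n 1)) => v.
by case: (b v).
Qed.

Lemma rec_andb n (b c : n.-tuple nat -> bool) :
  recursive (fun v => b v : nat) -> recursive (fun v => c v : nat) ->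
  recursive (fun v => b v && c v : nat).
Proof.
move=> rb rc; apply: rec_ext (rec_if rb rc (rec_const n 0)) => v.
by case: (b v).
Qed.

Lemma rec_orb n (b c : n.-tuple nat -> bool) :
  recursive (fun v => b v : nat) -> recursive (fun v => c v : nat) ->
  recursive (fun v => b v || c v : nat).
Proof.
move=> rb rc; apply: rec_ext (rec_if rb (rec_const n 1) rc) => v.
by case: (b v).
Qed.

Lemma rec_eqb n (b c : n.-tuple nat -> bool) :
  recursive (fun v => b v : nat) -> recursive (fun v => c v : nat) ->
  recursive (fun v => b v == c v : nat).
Proof.
move=> rb rc; apply: rec_ext (rec_if rb rc (rec_negb rc)) => v.
by case: (b v) (c v) => [] [].
Qed.

Lemma rec_leq n (F G : n.-tuple nat -> nat) :
  recursive F -> recursive G -> recursive (fun v => F v <= G v : nat).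
Proof.
move=> rF rG.
(* Subtraction is truncated, so [1 - (F v - G v)] is the truth value of the inequality. *)
apply: rec_ext (rec_sub (rec_const n 1) (rec_sub rF rG)) => v; lia.
Qed.

Lemma rec_eqn n (F G : n.-tuple nat -> nat) :
  recursive F -> recursive G -> recursive (fun v => F v == G v : nat).
Proof.
move=> rF rG.
apply: rec_ext (rec_andb (rec_leq rF rG) (rec_leq rG rF)) => v.
by rewrite -eqn_leq.
Qed.

Lemma rec_count n (B : n.-tuple nat -> nat) (P : n.-tuple nat -> nat -> bool) :
  recursive B ->
  recursive (fun v : n.+1.-tuple nat => P (behead_tup v) (thead v) : nat) ->
  recursive (fun v => count (P v) (iota 0 (B v))).
Proof.
move=> rB rP; pose F (v : n.+2.-tuple nat) : nat :=
  P (behead_tup (behead_tup v)) (thead v).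
have rF : recursive F.
  (* This substitution drops the accumulator, which [rec_natrec] places between the counter and the
     parameters. *)
  pose g (i : 'I_n.+1) (v : n.+2.-tuple nat) :=
    if unlift ord0 i is Some j then tnth v (lift ord0 (lift ord0 j))
    else thead v.
  have rg i : recursive (g i).
    by rewrite /g; case: (unlift ord0 i) => [j|]; apply: rec_proj.
  apply: rec_ext (rec_comp rP rg) => v; congr (nat_of_bool (P _ _)).
    by apply: eq_from_tnth => i; rewrite !tnth_mktuple /g liftK.
  by rewrite /thead tnth_mktuple /g unlift_none.
apply: rec_ext
  (rec_natrec (G := fun y r v => r + P v y) rB (rec_const n 0) _) => [v|].
  elim: (B v) => [|m IH] //.
  by rewrite -addn1 iotaD count_cat addn1 /= IH addn0.
by apply: rec_add rF; apply: rec_behead; apply: rec_thead.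
Qed.

Lemma rec_all_lt n (B : n.-tuple nat -> nat) (P : n.-tuple nat -> nat -> bool) :
  recursive B ->
  recursive (fun v : n.+1.-tuple nat => P (behead_tup v) (thead v) : nat) ->
  recursive (fun v => all_lt (B v) (P v) : nat).
Proof.
move=> rB rP; apply: rec_ext (rec_eqn (rec_count rB rP) rB) => v.
by rewrite /all_lt all_count size_iota.
Qed.

Lemma rec_has_lt n (B : n.-tuple nat -> nat) (P : n.-tuple nat -> nat -> bool) :
  recursive B ->
  recursive (fun v : n.+1.-tuple nat => P (behead_tup v) (thead v) : nat) ->
  recursive (fun v => has_lt (B v) (P v) : nat).
Proof.
move=> rB rP; apply: rec_ext (rec_leq (rec_const n 1) (rec_count rB rP)) => v.
by rewrite /has_lt has_count.
Qed.

Lemma rec_odd n (F : n.-tuple nat -> nat) :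
  recursive F -> recursive (fun v => odd (F v) : nat).
Proof.
move=> rF.
apply: rec_ext
  (rec_natrec (G := fun _ r _ => 1 - r) rF (rec_const n 0) _) => [v|].
  by elim: (F v) => [|m IH] //=; rewrite IH; case: (odd m).
by apply: rec_sub (rec_const _ _) _; apply: rec_behead; apply: rec_thead.
Qed.

Lemma rec_half n (F : n.-tuple nat -> nat) :
  recursive F -> recursive (fun v => (F v)./2).
Proof.
move=> rF.
apply: rec_ext
  (rec_natrec (G := fun y r _ => odd y + r) rF (rec_const n 0) _) => [v|].
  by elim: (F v) => [|m IH] //=; rewrite IH uphalf_half.
by apply: rec_add; [apply: rec_odd | apply: rec_behead]; apply: rec_thead.
Qed.

Lemma rec_bit n (F G : n.-tuple nat -> nat) :
  recursive F -> recursive G -> recursive (fun v => bit (F v) (G v) : nat).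
Proof.
move=> rF rG; apply: rec_odd.
apply: rec_ext (rec_natrec (G := fun _ r _ => r./2) rG rF _) => [v|].
  by elim: (G v) => [|m IH] //=; rewrite IH.
by apply: rec_half; apply: rec_behead; apply: rec_thead.
Qed.

Lemma rec_pair n (F G : n.-tuple nat -> nat) :
  recursive F -> recursive G -> recursive (fun v => pair (F v) (G v)).
Proof.
(* The Cantor pairing unfolds to [y] plus the triangular number of [y + x], itself given by
   recursion. *)
move=> rF rG; apply: (rec_add rG).
apply: (rec_natrec (F := fun=> 0) (G := fun y r _ => y.+1 + r)).
- exact: rec_add.
- exact: rec_const.
by apply: rec_add; [apply: rec_S | apply: rec_behead]; apply: rec_thead.
Qed.

Lemma rec_mul n (F G : n.-tuple nat -> nat) :
  recursive F -> recursive G -> recursive (fun v => F v * G v).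
Proof.
move=> rF rG.
apply: rec_ext
  (rec_natrec (G := fun _ r v => r + F v) rG (rec_const n 0) _) => [v|].
  by elim: (G v) => [|m IH] /=; rewrite ?IH; lia.
apply: rec_add; first by apply: rec_behead; apply: rec_thead.
exact: rec_behead (rec_behead rF).
Qed.

Lemma rec_exp n (F G : n.-tuple nat -> nat) :
  recursive F -> recursive G -> recursive (fun v => F v ^ G v).
Proof.
move=> rF rG.
apply: rec_ext
  (rec_natrec (G := fun _ r v => F v * r) rG (rec_const n 1) _) => [v|].
  by elim: (G v) => [|m IH] //=; rewrite IH expnS.
apply: rec_mul; first exact: rec_behead (rec_behead rF).
by apply: rec_behead; apply: rec_thead.
Qed.

(** Each bounded quantifier prepends a variable; this predicate lets a function of the outer
    variables be used below any number of quantifiers. *)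
Definition rec_subst m n (g : m.-tuple nat -> n.-tuple nat) : Prop :=
  forall F, recursive F -> recursive (fun v => F (g v)).

Lemma rec_subst_id n : rec_subst (fun v : n.-tuple nat => v).
Proof. by []. Qed.

Lemma rec_subst_behead m n (g : m.-tuple nat -> n.+1.-tuple nat) :
  rec_subst g -> rec_subst (fun v => behead_tup (g v)).
Proof.
by move=> rg F rF; apply/(rg (fun v => F (behead_tup v)))/rec_behead.
Qed.

Lemma rec_subst_thead m n (g : m.-tuple nat -> n.+1.-tuple nat) :
  rec_subst g -> recursive (fun v => thead (g v)).
Proof. by move=> rg; apply/(rg (fun v => thead v))/rec_thead. Qed.

Lemma rec_substE m n (F : n.-tuple nat -> nat)
    (g : m.-tuple nat -> n.-tuple nat) :
  recursive F -> rec_subst g -> recursive (fun v => F (g v)).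
Proof. by move=> rF; apply. Qed.

(* [rec_leq] must precede [rec_eqn], which otherwise applies by
   unfolding [leq]. *)
Ltac rec := repeat first
  [ assumption | apply: rec_const | apply: rec_subst_id
  | apply: rec_subst_behead
  | apply: rec_subst_thead
  | match goal with H : recursive _ |- _ => apply: (rec_substE H) end
  | apply: rec_all_lt | apply: rec_has_lt | apply: rec_count
  | apply: rec_bit | apply: rec_pair | apply: rec_eqb | apply: rec_leq
  | apply: rec_eqn | apply: rec_andb | apply: rec_orb | apply: rec_negb
  | apply: rec_add | apply: rec_mul | apply: rec_exp | apply: rec_S ].

(** * The algorithm *)

(* The relation coded by [r'] is specified rather than computed from [r]; as all
   states are below [N], digits for pairs outside [N * N] are irrelevant. *)
Definition upd (o : operator) (N r r' w v : nat) : bool :=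
  all_lt N (fun a => all_lt N (fun b =>
    bit r' (pair a b) ==
      (bit r (pair a b) && ~~ ((a == w) && (b == v))) ||
      (if o is Swap then (a == v) && (b == w) else false))).

Definition truth (T x r s w : nat) : bool := bit T (pair x (pair r (pair s w))).

(** One conjunct per constructor, with the tags of [code]; [y] and [z] stand for codes of immediate
    subformulas. The last clause guesses the updated relation [r']. *)
Definition tarski (o : operator) (N B c T y z r s w : nat) : bool :=
  [&& ~~ truth T (pair 0 0) r s w,
      truth T (pair 1 y) r s w == bit s (pair y w),
      truth T (pair 2 y) r s w == ~~ truth T y r s w,
      truth T (pair 3 (pair y z)) r s w == truth T y r s w && truth T z r s w,
      truth T (pair 4 y) r s w ==
        has_lt N (fun v => bit r (pair w v) && truth T y r s v) &
      truth T (pair 5 y) r s w ==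
        has_lt N (fun v => bit r (pair w v) &&
          has_lt B (fun r' => upd o N r r' w v && truth T y r' s v))].

Definition valid (o : operator) (N B c T : nat) : bool :=
  all_lt c.+1 (fun y => all_lt c.+1 (fun z => all_lt B (fun r =>
    all_lt B (fun s => all_lt N (fun w => tarski o N B c T y z r s w))))).

Lemma rec_valid o n (N B c T : n.-tuple nat -> nat) :
  recursive N -> recursive B -> recursive c -> recursive T ->
  recursive (fun e => valid o (N e) (B e) (c e) (T e) : nat).
Proof.
move=> rN rB rc rT; rewrite /valid /tarski /truth /upd.
case: o; rec.
Qed.

Definition accepts (k N B c T : nat) : bool :=
  has_lt B (fun r => has_lt B (fun s =>
    all_lt N (fun w => count (fun v => bit r (pair w v)) (iota 0 N) <= k) &&
    has_lt N (fun w => truth T c r s w))).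

Lemma rec_accepts k n (N B c T : n.-tuple nat -> nat) :
  recursive N -> recursive B -> recursive c -> recursive T ->
  recursive (fun e => accepts k (N e) (B e) (c e) (T e) : nat).
Proof. move=> rN rB rc rT; rewrite /accepts /truth; rec. Qed.

(** The code [c] serves as a bound on the modal depth, which thus need not be computed. *)
Definition num_worlds (k c : nat) : nat := k.+1 ^ c.

(* [num_worlds k c + c] also bounds the symbols of a formula of code [c], which
   index the digits of a valuation. *)
Definition num_bound (k c : nat) : nat :=
  2 ^ (pair (num_worlds k c + c) (num_worlds k c + c)).+1.

Lemma rec_num_worlds k n (c : n.-tuple nat -> nat) :
  recursive c -> recursive (fun e => num_worlds k (c e)).
Proof. by move=> rc; rewrite /num_worlds; rec. Qed.

Lemma rec_num_bound k n (c : n.-tuple nat -> nat) :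
  recursive c -> recursive (fun e => num_bound k (c e)).
Proof. by move=> rc; rewrite /num_bound /num_worlds; rec. Qed.

(** * Bounded quantifiers, pairing and binary digits *)

Lemma all_ltP b (P : nat -> bool) :
  reflect (forall x, x < b -> P x) (all_lt b P).
Proof.
by apply: (iffP allP) => H x; have := H x; rewrite mem_iota.
Qed.

Lemma has_ltP b (P : nat -> bool) :
  reflect (exists2 x, x < b & P x) (has_lt b P).
Proof.
by apply: (iffP hasP) => -[x ltxb Px]; exists x => //;
  rewrite mem_iota in ltxb *.
Qed.

Lemma leq_addn_pair x y : x + y <= pair x y.
Proof. by have := Cantor.to_nat_non_decreasing x y; rewrite /pair; lia. Qed.

(** Twice the pairing is a polynomial with nonnegative coefficients. *)
Lemma leq_pair x y x' y' : x <= x' -> y <= y' -> pair x y <= pair x' y'.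
Proof.
move=> lex ley.
have := Cantor.to_nat_spec x y; have := Cantor.to_nat_spec x' y'.
rewrite /pair; nia.
Qed.

Lemma bit_surj L (b : nat -> bool) :
  (* The lowest digit is [b 0]; the remaining ones are those of a number for the shifted pattern. *)
  exists2 t, t < 2 ^ L & forall i, i < L -> bit t i = b i.
Proof.
elim: L b => [|L IH] b; first by exists 0.
have [t ltt tb] := IH (fun i => b i.+1); exists (b 0 + t.*2).
  by rewrite expnS; case: (b 0); lia.
case=> [_|i ltiL]; rewrite /bit.
  by rewrite /= oddD odd_double oddb addbF.
by rewrite iterSr half_bit_double; apply: tb.
Qed.

Lemma bit_pair_surj a b (P : nat -> nat -> bool) :
  exists2 t, t < 2 ^ (pair a b).+1 &
    forall x y, x <= a -> y <= b -> bit t (pair x y) = P x y.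
Proof.
have [t ltt tP] := bit_surj (pair a b).+1
  (fun i => let: (x, y) := Cantor.of_nat i in P x y).
exists t => // x y lex ley; rewrite tP ?Cantor.cancel_of_to //.
by rewrite ltnS leq_pair.
Qed.

(** * Truth tables of numerical models *)

Lemma updateE o (M : model) (u v : M) e :
  update o u v e <-> acc M e /\ e <> (u, v) \/ o = Swap /\ e = (v, u).
Proof.
case: o; first by split; [left | case=> [|[]]].
by split=> [[|->]|[|[_ ->]]]; [left|right|left|right].
Qed.

(** The carrier is [nat] whatever [N] is, with the states from [N] on isolated; an update then only
    changes [r]. *)
Definition num_model (N r s : nat) : model :=
  @Model nat (inhabits 0)
    [set e | [&& e.1 < N, e.2 < N & bit r (pair e.1 e.2)]]
    (fun p w => bit s (pair p w)).

(** An equality of sets, so that it can be rewritten inside a model. The bounds on [w] and [v] keep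
    a swapped edge among the pairs below [N]. *)
Lemma num_model_update o N r r' s (w v : num_model N r s) :
  w < N -> v < N -> upd o N r r' w v ->
  update o w v = acc (num_model N r' s).
Proof.
move=> ltw ltv /all_ltP updr.
apply/funext => -[a b]; apply/propext; rewrite updateE /=.
have pairE (x y p q : nat) : (x, y) = (p, q) <-> (x == p) && (y == q).
  by split=> [[-> ->]|/andP[/eqP-> /eqP->]]; rewrite ?eqxx.
rewrite !pairE; case: (ltnP a N) => lta; last first.
  by split=> // -[[]|[_ /andP[/eqP av]]] //; lia.
case: (ltnP b N) => ltb.
  have /all_ltP/(_ _ ltb)/eqP-> := updr _ lta.
  case: o {updr} => /=; rewrite ?orbF.
    by split=> [[[-> /negP->]|[]]|/andP[-> /negP ne]] //; left.
  split=> [[[-> /negP->]|[_ ->]]|/orP[/andP[-> /negP ne]|vw]] //.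
  - by rewrite orbT.
  - by left.
  - by right.
by split=> // -[[]|[_ /andP[_ /eqP bw]]] //; lia.
Qed.

Lemma upd_total o k c r w v :
  exists2 r', r' < num_bound k c & upd o (num_worlds k c) r r' w v.
Proof.
have [r' ltr' r'P] := bit_pair_surj (num_worlds k c + c) (num_worlds k c + c)
  (fun a b => (bit r (pair a b) && ~~ ((a == w) && (b == v))) ||
      (if o is Swap then (a == v) && (b == w) else false)).
exists r' => //; apply/all_ltP => a lta; apply/all_ltP => b ltb.
by rewrite r'P //; lia.
Qed.

(* Decoding is total, so that a truth table exists even for inputs that are not
   codes of formulas. *)
Definition decode_step (dec : nat -> formula) (x : nat) : formula :=
  match Cantor.of_nat x with
  | (1, p) => Var p
  | (2, y) => Neg (dec y)
  | (3, yz) => let: (y, z) := Cantor.of_nat yz in And (dec y) (dec z)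
  | (4, y) => Dia (dec y)
  | (5, y) => Op (dec y)
  | _ => Bot
  end.

Definition decode (x : nat) : formula := iter x.+1 decode_step (fun=> Bot) x.

(** A nonzero tag makes every component smaller than the whole code, so once the number of
    iterations exceeds the argument, further ones change nothing. *)
Lemma decode_stepE x : decode x = decode_step decode x.
Proof.
have stable n m y : y < n -> y < m ->
    iter n decode_step (fun=> Bot) y = iter m decode_step (fun=> Bot) y.
  elim: n m y => // n IH [//|m] y ltyn ltym; rewrite !iterS /decode_step.
  case E: (Cantor.of_nat y) => [t a].
  have yE : y = pair t a by rewrite /pair -E Cantor.cancel_to_of.
  have lea := leq_addn_pair t a.
  case: t => [|[|[|[|[|[|t]]]]]] // in E yE lea *;
    try by rewrite (IH m) //; lia.
  case F: (Cantor.of_nat a) => [b d].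
  have aE : a = pair b d by rewrite /pair -F Cantor.cancel_to_of.
  have leb := leq_addn_pair b d.
  by rewrite (IH m b) ?(IH m d) //; lia.
rewrite {1}/decode iterS {1 3}/decode_step.
case E: (Cantor.of_nat x) => [t a].
have xE : x = pair t a by rewrite /pair -E Cantor.cancel_to_of.
have lea := leq_addn_pair t a.
have dec y : y < x -> iter x decode_step (fun=> Bot) y = decode y.
  by move=> lty; apply: stable.
case: t => [|[|[|[|[|[|t]]]]]] // in E xE lea *; try by rewrite dec //; lia.
case F: (Cantor.of_nat a) => [b d].
have aE : a = pair b d by rewrite /pair -F Cantor.cancel_to_of.
have leb := leq_addn_pair b d.
by rewrite !dec //; lia.
Qed.

Lemma decode_pairE :
  [/\ decode (pair 0 0) = Bot,
      forall y, decode (pair 1 y) = Var y,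
      forall y, decode (pair 2 y) = Neg (decode y),
      forall y z, decode (pair 3 (pair y z)) = And (decode y) (decode z) &
      (forall y, decode (pair 4 y) = Dia (decode y)) *
      (forall y, decode (pair 5 y) = Op (decode y))].
Proof.
by split; [|move=> y|move=> y|move=> y z|split=> y];
  rewrite decode_stepE /decode_step !Cantor.cancel_of_to.
Qed.

Definition sat (o : operator) (N r s w : nat) (phi : formula) : bool :=
  `[< @satisfies o (num_model N r s) w phi >].

Lemma sat_Dia o N r s w phi : w < N ->
  sat o N r s w (Dia phi) =
    has_lt N (fun v => bit r (pair w v) && sat o N r s v phi).
Proof.
move=> ltw; apply/asboolP/has_ltP => /=.
  move=> [v [/and3P[_ ltv rwv] sv]]; exists v => //.
  by rewrite rwv; apply/asboolP.
by move=> [v ltv /andP[rwv /asboolP sv]]; exists v; rewrite ltw ltv rwv.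
Qed.

(** Every update of a coded relation has a code below the bound by [upd_total], so the guess of [r']
    always succeeds. *)
Lemma sat_Op o k c r s w phi : let N := num_worlds k c in w < N ->
  sat o N r s w (Op phi) = has_lt N (fun v => bit r (pair w v) &&
    has_lt (num_bound k c) (fun r' => upd o N r r' w v && sat o N r' s v phi)).
Proof.
move=> N ltw; apply/asboolP/has_ltP.
  move=> [v [/= /and3P[_ ltv rwv] sv]]; exists v => //; rewrite rwv /=.
  have [r' ltr' updr] := upd_total o k c r w v.
  apply/has_ltP; exists r' => //; rewrite updr /=; apply/asboolP.
  by move: sv; rewrite /with_acc (num_model_update ltw ltv updr).
move=> [v ltv /andP[rwv /has_ltP[r' ltr' /andP[updr /asboolP sv]]]].
exists v; split; first by rewrite /= ltw ltv.
by rewrite /with_acc (num_model_update ltw ltv updr).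
Qed.

Lemma sat_Bot o N r s w : sat o N r s w Bot = false.
Proof. exact: asboolF. Qed.

Lemma sat_Var o N r s w p : sat o N r s w (Var p) = bit s (pair p w).
Proof. exact: asboolb. Qed.

Lemma sat_Neg o N r s w phi : sat o N r s w (Neg phi) = ~~ sat o N r s w phi.
Proof. exact: asbool_neg. Qed.

Lemma sat_And o N r s w phi psi :
  sat o N r s w (And phi psi) = sat o N r s w phi && sat o N r s w psi.
Proof. exact: asbool_and. Qed.

Lemma eq_has_lt b (P Q : nat -> bool) :
  (forall x, x < b -> P x = Q x) -> has_lt b P = has_lt b Q.
Proof. by move=> PQ; apply: eq_in_has => x; rewrite mem_iota; apply: PQ. Qed.

(** The clauses determine the table by induction on the formula, since subformulas have smaller
    codes. The relation [r] varies in the induction because of [Op]. *)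
Lemma valid_truth o k c T phi r s w :
  valid o (num_worlds k c) (num_bound k c) c T ->
  code phi <= c -> r < num_bound k c -> s < num_bound k c ->
  w < num_worlds k c ->
  truth T (code phi) r s w = sat o (num_worlds k c) r s w phi.
Proof.
move=> /all_ltP valT.
have {valT} valT y z r' s' v : y <= c -> z <= c -> r' < num_bound k c ->
    s' < num_bound k c -> v < num_worlds k c ->
    tarski o (num_worlds k c) (num_bound k c) c T y z r' s' v.
  move=> ley lez ltr lts ltv.
  have /all_ltP/(_ _ lez)/all_ltP/(_ _ ltr) := valT _ ley.
  by move/all_ltP/(_ _ lts)/all_ltP/(_ _ ltv).
elim: phi r w => [|p|phi IH|phi IH1 psi IH2|phi IH|phi IH] r w; cbn [code];
  rewrite -!/(pair _ _) => lec ltr lts ltw.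
(* Codes that a clause does not mention are instantiated with [0]. *)
- have /andP[/negbTE-> _] := valT 0 0 _ _ _ isT isT ltr lts ltw.
  by rewrite sat_Bot.
- have lep : p <= c by have := leq_addn_pair 1 p; lia.
  have /and3P[_ /eqP-> _] := valT _ 0 _ _ _ lep isT ltr lts ltw.
  by rewrite sat_Var.
- have lep : code phi <= c by have := leq_addn_pair 2 (code phi); lia.
  have /and4P[_ _ /eqP-> _] := valT _ 0 _ _ _ lep isT ltr lts ltw.
  by rewrite sat_Neg IH.
- have := leq_addn_pair 3 (pair (code phi) (code psi)).
  have := leq_addn_pair (code phi) (code psi) => le1 le2.
  have lep : code phi <= c by lia.
  have leq : code psi <= c by lia.
  have /and5P[_ _ _ /eqP-> _] := valT _ _ _ _ _ lep leq ltr lts ltw.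
  by rewrite sat_And IH1 ?IH2.
- have lep : code phi <= c by have := leq_addn_pair 4 (code phi); lia.
  have /and5P[_ _ _ _ /andP[/eqP-> _]] := valT _ 0 _ _ _ lep isT ltr lts ltw.
  by rewrite sat_Dia //; apply: eq_has_lt => v ltv; rewrite IH.
- have lep : code phi <= c by have := leq_addn_pair 5 (code phi); lia.
  have /and5P[_ _ _ _ /andP[_ /eqP->]] := valT _ 0 _ _ _ lep isT ltr lts ltw.
  rewrite (sat_Op o r s phi ltw); apply: eq_has_lt => v ltv; congr (_ && _).
  by apply: eq_has_lt => r' ltr'; rewrite IH.
Qed.

Lemma valid_exists o k c :
  exists T, valid o (num_worlds k c) (num_bound k c) c T.
Proof.
set N := num_worlds k c; set B := num_bound k c.
(* [X] bounds every formula code read by [tarski]: 5 is the largest tag, and arguments are at most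
   [pair c c]. The table records the truth of [decode x]. *)
pose X := pair 5 (pair c c).
have [T _ TP] := bit_pair_surj X (pair B (pair B N)) (fun x i =>
  let: (r, sw) := Cantor.of_nat i in let: (s, w) := Cantor.of_nat sw in
  sat o N r s w (decode x)).
have {}TP x r s w : x <= X -> r < B -> s < B -> w < N ->
    truth T x r s w = sat o N r s w (decode x).
  move=> lex ltr lts ltw; rewrite /truth TP ?Cantor.cancel_of_to //.
  by rewrite !leq_pair // ltnW.
have leX t y : t <= 5 -> y <= pair c c -> pair t y <= X.
  by move=> *; apply: leq_pair.
have lec : c <= pair c c by have := leq_addn_pair c c; lia.
have leX' : pair c c <= X.
  by have := leq_addn_pair 5 (pair c c); rewrite -/X; lia.
have [dec0 dec1 dec2 dec3 [dec4 dec5]] := decode_pairE.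
exists T; apply/all_ltP => y; rewrite ltnS => ley.
apply/all_ltP => z; rewrite ltnS => lez.
apply/all_ltP => r ltr; apply/all_ltP => s lts; apply/all_ltP => w ltw.
have leyz := leq_pair ley lez.
rewrite /tarski !TP ?leX //; try lia.
rewrite dec0 dec1 dec2 dec3 dec4 dec5.
rewrite sat_Bot sat_Var sat_Neg sat_And sat_Dia // (sat_Op o r s _ ltw).
rewrite !eqxx /=.
have E v r' : v < N -> r' < B -> truth T y r' s v = sat o N r' s v (decode y).
  by move=> ltv ltr'; rewrite TP //; lia.
apply/andP; split; apply/eqP; apply: eq_has_lt => v ltv; first by rewrite E.
by congr (_ && _); apply: eq_has_lt => r' ltr'; rewrite E.
Qed.

(** * Bounded model property *)

Lemma card_set_uniq_seq (s : seq nat) : uniq s -> [set` s] #= `I_(size s).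
Proof.
move=> us; have -> : [set` s] = ((nth 0 s) @` `I_(size s)).
  apply/seteqP; split=> x /=.
    by exists (index x s); rewrite /= ?index_mem ?nth_index.
  by move=> [i lti <-]; apply: mem_nth.
apply: inj_card_eq => i j; rewrite !inE => lti ltj /eqP.
by rewrite nth_uniq // => /eqP.
Qed.

Lemma num_model_width k N r s :
  width_le k (num_model N r s) <->
  forall w, w < N -> count (fun v => bit r (pair w v)) (iota 0 N) <= k.
Proof.
have succE w : w < N -> [set v | acc (num_model N r s) (w, v)] =
    [set` [seq v <- iota 0 N | bit r (pair w v)]].
  move=> ltw; apply/seteqP; split=> v /=; rewrite mem_filter mem_iota ltw /=.
    by move=> /andP[-> ->].
  by move=> /andP[-> ->].
have cardE w : w < N -> ([set v | acc (num_model N r s) (w, v)] #<= `I_k) =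
    (count (fun v => bit r (pair w v)) (iota 0 N) <= k).
  move=> ltw; rewrite succE // (card_le_eql (card_set_uniq_seq _)).
    by rewrite card_le_II size_filter.
  by rewrite filter_uniq // iota_uniq.
split=> [H w ltw|H w]; first by rewrite -cardE.
case: (ltnP w N) => [ltw|leNw]; first by rewrite cardE // H.
rewrite (_ : [set v | _] = set0) ?card_ge0 //.
by apply/seteqP; split=> // v /=; rewrite ltnNge leNw.
Qed.

(* [A i] are the states from which [i] steps may still be taken.
   [code phi] bounds both the modal depth and the symbols of [phi].
   After a swap along [(u, v)] the new edge leads back to [u], which lies in
   [A n.+1] and hence in every [A i] that is still relevant. *)
Lemma satisfies_transfer o phi (M1 M2 : model) (g : M1 -> M2)
    (A : nat -> set M1) (n : nat) :
  code phi <= n ->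
  (forall i j, i <= j -> A j `<=` A i) ->
  (forall i u v, i < n -> A i.+1 u -> acc M1 (u, v) -> A i v) ->
  {in A 0 &, injective g} ->
  (forall u v, A 0 u -> A 0 v -> acc M1 (u, v) <-> acc M2 (g u, g v)) ->
  (forall u y, A 0 u -> acc M2 (g u, y) -> exists2 v, A 0 v & y = g v) ->
  (forall p u, p <= n -> A 0 u -> valuation M1 p u <-> valuation M2 p (g u)) ->
  forall u, A n u -> satisfies o u phi <-> satisfies o (g u) phi.
Proof.
elim: phi M1 M2 g A n => [|p|phi IH|phi IH1 psi IH2|phi IH|phi IH] M1 M2 g A n;
  cbn [code]; rewrite -!/(pair _ _) => len anti fwd injg accE back valE u Au /=.
- by [].
- have := leq_addn_pair 1 p => lep; apply: valE; first by lia.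
  exact: anti Au.
- have := leq_addn_pair 2 (code phi) => lep.
  by rewrite (IH M1 M2 g A n) //; lia.
- have := leq_addn_pair 3 (pair (code phi) (code psi)).
  have := leq_addn_pair (code phi) (code psi) => le1 le2.
  by rewrite (IH1 M1 M2 g A n) ?(IH2 M1 M2 g A n) //; lia.
- have := leq_addn_pair 4 (code phi).
  case: n => [|n] in len fwd valE Au *; first by lia.
  move=> lep; have Au0 : A 0 u by apply: anti Au.
  have {}IH v : A n v -> satisfies o v phi <-> satisfies o (g v) phi.
    apply: IH => //; first by lia.
      by move=> i a b ltin; apply: fwd; lia.
    by move=> p a lepn; apply: valE; lia.
  split=> [[v [uv sv]]|[y [uy sy]]].
    have Av := fwd _ _ _ (ltnSn n) Au uv; exists (g v).
    by rewrite -accE ?IH // in sv *; apply: anti Av.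
  have [v Av0 yE] := back _ _ Au0 uy; rewrite yE in uy sy.
  have uv : acc M1 (u, v) by apply/accE.
  exists v; split=> //; apply/IH => //; exact: fwd Au uv.
- have := leq_addn_pair 5 (code phi).
  case: n => [|n] in len fwd valE Au *; first by lia.
  move=> lep; have Au0 : A 0 u by apply: anti Au.
  have {}IH v : A n v -> acc M1 (u, v) ->
      @satisfies o (with_acc (update o u v)) v phi <->
      @satisfies o (with_acc (update o (g u) (g v))) (g v) phi.
    move=> Av uv; have Av0 : A 0 v by apply: anti Av.
    (* Injectivity on [A 0] makes deleting and adding edges commute with [g], so the updated models
       again satisfy the hypotheses. *)
    have pairE a b c d : A 0 a -> A 0 b -> A 0 c -> A 0 d ->
        (a, b) = (c, d) <-> (g a, g b) = (g c, g d).
      move=> Aa Ab Ac Ad; split=> [[-> ->]//|[ac bd]].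
      by congr (_, _); apply: injg; rewrite ?inE.
    apply: (IH (with_acc _) (with_acc _) g A n) => //.
    + lia.
    + move=> i a b ltin Aa /updateE[[ab _]|[_ [_ ->]]].
        by apply: fwd Aa ab; lia.
      by apply: anti Au; lia.
    + by move=> a b Aa Ab; rewrite /= !updateE accE // !(pairE a b).
    + move=> a y Aa /updateE[[/(back _ _ Aa)//]|[_ [_ ->]]]; by exists u.
    + by move=> p a lepn; apply: valE; lia.
  split=> [[v [uv sv]]|[y [uy sy]]].
    have Av := fwd _ _ _ (ltnSn n) Au uv; exists (g v).
    by rewrite -accE -?IH //; apply: anti Av.
  have [v Av0 yE] := back _ _ Au0 uy; rewrite yE in uy sy.
  have uv : acc M1 (u, v) by apply/accE.
  exists v; split=> //; apply/IH => //; exact: fwd Au uv.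
Qed.

Fixpoint reach (M : model) (w : M) (n : nat) : set M :=
  if n is m.+1 then
    [set v | reach w m v \/ exists2 u, reach w m u & acc M (u, v)]
  else [set w].

(** A path of at most [n] steps is a numeral of [n] digits in base [k.+1]: digit 0 stays in place
    and digit [i.+1] moves to successor number [i]. *)
Lemma reach_enum k (M : model) (w : M) n : width_le k M ->
  exists e : nat -> M,
    forall u, reach w n u -> exists2 a, a < k.+1 ^ n & e a = u.
Proof.
move=> widthM.
have [succ succP] : exists succ : M -> nat -> M,
    forall u v, acc M (u, v) -> exists2 i, i < k & succ u i = v.
  have : forall u, exists f : nat -> M,
      forall v, acc M (u, v) -> exists2 i, i < k & f i = v.
    move=> u; have /pcard_leP[f] := widthM u.
    (* [h] inverts the injection [f] of the successors of [u] into [I_k], with default value [u]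
       outside the image. *)
    have /choice[h hP] : forall i, exists v,
        (exists v, acc M (u, v) /\ f v = i) -> acc M (u, v) /\ f v = i.
      move=> i; have [[v H]|H] := pselect (exists v, acc M (u, v) /\ f v = i).
        by exists v.
      by exists u => /H.
    exists h => v uv; exists (f v); first exact: (@funS _ _ _ _ f _ uv).
    have [uv' fE] := hP (f v) (ex_intro _ v (conj uv erefl)).
    by apply: (@inj _ _ _ f) => //; rewrite inE.
  by move=> /choice[succ ?]; exists succ.
elim: n => [|n [e eP]]; first by exists (fun=> w) => u ->; exists 0.
exists (fun a =>
  if a %% k.+1 is i.+1 then succ (e (a %/ k.+1)) i else e (a %/ k.+1)).
move=> v [/eP[a lta <-]|[u /eP[a lta <-] /succP[i lti <-]]].
  by exists (a * k.+1); rewrite ?modnMl ?mulnK // expnS mulnC ltn_pmul2l.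
exists (a * k.+1 + i.+1); last first.
  by rewrite modnMDl divnMDl // modn_small ?divn_small ?addn0.
by rewrite expnS; nia.
Qed.

(** The model is restricted to the states reachable within [c] steps, which are renumbered by [g];
    [e] inverts [g] there, so [g] is injective on them. *)
Lemma num_model_property o k phi : let c := code phi in
  satisfiable o k phi ->
  exists r s w, [/\ r < num_bound k c, s < num_bound k c, w < num_worlds k c,
    width_le k (num_model (num_worlds k c) r s) &
    sat o (num_worlds k c) r s w phi].
Proof.
move=> c [M [widthM [w0 sat0]]]; set N := num_worlds k c.
have [e eP] := reach_enum w0 c widthM.
have /choice[g gP] : forall u, exists a, reach w0 c u -> a < N /\ e a = u.
  move=> u; have [/eP[a lta ae]|nu] := pselect (reach w0 c u).
    by exists a.
  by exists 0.
(* [N + c] covers both the states, below [N], and the symbols, at most [c], as in [num_bound]. *)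
have [r ltr rP] := bit_pair_surj (N + c) (N + c) (fun a b =>
  `[< exists u v,
    [/\ reach w0 c u, reach w0 c v, g u = a, g v = b & acc M (u, v)] >]).
have [s lts sP] := bit_pair_surj (N + c) (N + c) (fun p a =>
  `[< exists u, [/\ reach w0 c u, g u = a & valuation M p u] >]).
have ginj u v : reach w0 c u -> reach w0 c v -> g u = g v -> u = v.
  by move=> /gP[_ {2}<-] /gP[_ {2}<-] ->.
have ltg u : reach w0 c u -> g u < N by move=> /gP[].
have reach_sub i j : i <= j -> reach w0 i `<=` reach w0 j.
  elim: j => [|j IH]; first by rewrite leqn0 => /eqP->.
  by rewrite leq_eqVlt => /orP[/eqP->//|/IH leij u /leij]; left.
have reach0 : reach w0 c w0 by apply: (reach_sub 0).
have accP u y : reach w0 c u -> acc (num_model N r s) (g u, y) <->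
    exists v, [/\ reach w0 c v, g v = y & acc M (u, v)].
  move=> Au; split=> /= [/and3P[_ lty]|[v [Av <- uv]]].
    rewrite rP; [|by have := ltg _ Au; lia|by lia].
    move=> /asboolP[u' [v [Au' Av gu' gv uv]]]; exists v; split=> //.
    by rewrite -(ginj _ _ Au' Au gu').
  rewrite !ltg //= rP; [|by have := ltg _ Au; lia|by have := ltg _ Av; lia].
  by apply/asboolP; exists u, v.
exists r, s, (g w0); split=> //; first exact: ltg.
  move=> a.
  have [[u [Au <-]]|na] := pselect (exists u, reach w0 c u /\ g u = a);
    last first.
    rewrite (_ : [set v | _] = set0) ?card_ge0 //.
    apply/seteqP; split=> // b /= /and3P[lta ltb]; rewrite rP; [|lia|lia].
    move=> /asboolP[u [v [Au _ gu _ _]]].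
    by case: na; exists u.
  (* The successors of [g u] are images under [g] of successors of [u]. *)
  apply: card_le_trans (widthM u); apply: card_le_trans (card_image_le g _).
  by apply: subset_card_le => b /= /(accP _ _ Au)[v [_ <- uv]]; exists v.
apply/asboolP.
(* With [i] steps left, at most [c - i] have been taken; the family runs from [w0] alone at [i = c]
   to all retained states at [i = 0]. *)
have [] // := @satisfies_transfer o phi M (num_model N r s) g
  (fun i => reach w0 (c - i)) c _ _ _ _ _ _ _ w0.
- by move=> i j leij; apply: reach_sub; lia.
- move=> i u v ltic Au uv; rewrite (_ : c - i = (c - i.+1).+1); last lia.
  by right; exists u.
- by move=> u v; rewrite !inE subn0 => Au Av; apply: ginj.
- move=> u v; rewrite subn0 => Au Av; rewrite accP //.
  split=> [uv|[v' [Av' /ginj gE]]].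
    by exists v.
  by rewrite gE.
- by move=> u y; rewrite subn0 => Au /(accP _ _ Au)[v [Av <- _]]; exists v.
- move=> p u lep; rewrite subn0 => Au /=.
  rewrite sP; [|by lia|by have := ltg _ Au; lia]; split.
    by move=> pu; apply/asboolP; exists u.
  by move=> /asboolP[v [Av /ginj <-]].
- by rewrite subnn.
- by move=> /(_ sat0).
Qed.

(** * Correctness of the search and decidability *)

Lemma acceptsP o k phi T : let c := code phi in
  valid o (num_worlds k c) (num_bound k c) c T ->
  accepts k (num_worlds k c) (num_bound k c) c T = `[< satisfiable o k phi >].
Proof.
move=> c valT; apply/has_ltP/asboolP.
  move=> [r ltr /has_ltP[s lts /andP[/all_ltP wd /has_ltP[w ltw]]]].
  rewrite (valid_truth valT) // => /asboolP sw.
  exists (num_model (num_worlds k c) r s).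
  by split; [apply/num_model_width|exists w].
move=> /num_model_property[r [s [w [ltr lts ltw /num_model_width wd sw]]]].
exists r => //; apply/has_ltP; exists s => //; apply/andP; split.
  exact/all_ltP.
by apply/has_ltP; exists w; rewrite // (valid_truth valT).
Qed.

Theorem corollary2 (o : operator) (k : nat) : decidable_set (satisfiable o k).
Proof.
(* A valid table exists for every input, code or not, so minimization is regular; the least one
   serves, as any valid table gives the right answer. *)
have exT (v : 1.-tuple nat) := valid_exists o k (thead v).
pose T v := ex_minn (exT v).
exists (fun v => accepts k (num_worlds k (thead v)) (num_bound k (thead v))
  (thead v) (T v)).
split=> [|phi].
  apply: rec_accepts.
  - exact/rec_num_worlds/rec_thead.
  - exact/rec_num_bound/rec_thead.
  - exact: rec_thead.
  apply: rec_search; apply: rec_valid; last exact: rec_thead.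
  - by apply: rec_num_worlds; rec.
  - by apply: rec_num_bound; rec.
  - by rec.
have : valid o (num_worlds k (thead [tuple code phi]))
    (num_bound k (thead [tuple code phi])) (thead [tuple code phi])
    (T [tuple code phi]).
  by rewrite /T; case: ex_minnP.
by rewrite theadE => /acceptsP->.
Qed.
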